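(* Let $n \ge 2$ and let $\mathcal{O} \subset F_n$ be a subset contained in the union of finitely many $\mathrm{Aut}(F_n)$-orbits. Then there exists a finite-index normal subgroup $R \lhd F_n$ such that $H_1^{\mathcal{O}}(R;\mathbb{Q}) \neq H_1(R;\mathbb{Q})$.
   Context: $F_n$ is the free group on $n$ generators, and $\mathrm{Aut}(F_n)$ acts on the set $F_n$ in the natural way. For a subset $\mathcal{O} \subset F_n$ and a finite-index subgroup $R < F_n$, $H_1^{\mathcal{O}}(R;\mathbb{Q})$ is the $\mathbb{Q}$-span in $H_1(R;\mathbb{Q})$ of the set of all classes $[x^k] \in H_1(R;\mathbb{Q})$ such that $x \in \mathcal{O}$ and $k \ge 1$ is such that $x^k \in R$. *)

(* Defs.v *)
From HB Require Import structures.
From mathcomp Require Import all_boot all_algebra all_classical.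
From mathcomp Require Import freeg.

Set Implicit Arguments.
Unset Strict Implicit.
Unset Printing Implicit Defensive.

Import GRing.Theory.

Local Open Scope classical_set_scope.
Local Open Scope ring_scope.
Local Open Scope quotient_scope.

Section FreeGroup.
Variable X : choiceType.

(* The letter (x, false) stands for x, and (x, true) for its inverse. *)
Definition letter : Type := X * bool.
HB.instance Definition _ := Choice.on letter.

Definition letter_inv (a : letter) : letter := (a.1, ~~ a.2).

Definition reduced_word (w : seq letter) : bool :=
  sorted (fun a b => b != letter_inv a) w.

Record free_group := FreeGroup {
  word_of :> seq letter;
  _ : reduced_word word_of }.

HB.instance Definition _ := [isSub for word_of].
HB.instance Definition _ := [Choice of free_group by <:].

(* The reduced form of a :: w, for w reduced. *)
Definition push (a : letter) (w : seq letter) : seq letter :=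
  if w is b :: w' then if b == letter_inv a then w' else a :: w else [:: a].

(* The reduced form of u ++ v, for v reduced. *)
Definition word_mul (u v : seq letter) : seq letter := foldr push v u.
Definition word_inv (u : seq letter) : seq letter := rev (map letter_inv u).

Lemma letter_invK : involutive letter_inv.
Proof. by case=> x b; rewrite /letter_inv /= negbK. Qed.

Lemma reduced_behead a w : reduced_word (a :: w) -> reduced_word w.
Proof. by case: w => [|b w] //= /andP[]. Qed.

Lemma push_reduced a w : reduced_word w -> reduced_word (push a w).
Proof.
case: w => [|b w] // rw; rewrite /push.
by case: ifP => [_|/negbT ne]; [exact: reduced_behead rw | rewrite /= ne].
Qed.

Lemma word_mul_reduced u v : reduced_word v -> reduced_word (word_mul u v).
Proof. by move=> rv; elim: u => //= a u; exact: push_reduced. Qed.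

Lemma pushK a w : reduced_word w -> push a (push (letter_inv a) w) = w.
Proof.
case: w => [|b w] /= rw; first by rewrite eqxx.
rewrite letter_invK; case: eqP => [eba|_] /=; last by rewrite eqxx.
case: w rw => [|c w] /=; rewrite eba //.
by case/andP => /negPf ->.
Qed.

Lemma word_mul_push a v w : reduced_word w ->
  word_mul (push a v) w = push a (word_mul v w).
Proof.
move=> rw; case: v => [|b v] //=; case: eqP => [->|] //.
by rewrite /= pushK //; exact: word_mul_reduced.
Qed.

Lemma word_mulA u v w : reduced_word w ->
  word_mul u (word_mul v w) = word_mul (word_mul u v) w.
Proof. by move=> rw; elim: u => //= a u ->; rewrite word_mul_push. Qed.

Lemma word_mulw0 u : reduced_word u -> word_mul u [::] = u.
Proof.
elim: u => //= a u IHu rau; rewrite IHu; last exact: reduced_behead rau.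
by case: u rau {IHu} => //= b u /andP[/negPf ->].
Qed.

Lemma word_invK : involutive word_inv.
Proof.
move=> u; rewrite /word_inv map_rev revK -map_comp.
by rewrite (eq_map (g := id)) ?map_id // => a /=; rewrite letter_invK.
Qed.

Lemma word_inv_reduced u : reduced_word u -> reduced_word (word_inv u).
Proof.
rewrite /reduced_word /word_inv rev_sorted sorted_map; apply: sub_sorted => a b.
by rewrite /= letter_invK eq_sym (inv_eq letter_invK).
Qed.

Lemma word_mulVw u : word_mul (word_inv u) u = [::].
Proof.
elim: u => // a u IHu; rewrite /word_inv /= rev_cons /word_mul foldr_rcons /=.
by rewrite letter_invK eqxx.
Qed.

Definition fg_one : free_group := @FreeGroup [::] isT.
Definition fg_mul (u v : free_group) : free_group :=
  FreeGroup (word_mul_reduced u (valP v)).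
Definition fg_inv (u : free_group) : free_group :=
  FreeGroup (word_inv_reduced (valP u)).

Lemma fg_mulA : associative fg_mul.
Proof. by move=> u v w; apply: val_inj; apply: word_mulA; exact: valP. Qed.
Lemma fg_mul1g : left_id fg_one fg_mul.
Proof. by move=> u; apply: val_inj. Qed.
Lemma fg_mulg1 : right_id fg_one fg_mul.
Proof. by move=> u; apply: val_inj; apply: word_mulw0; exact: valP. Qed.
Lemma fg_mulVg : left_inverse fg_one fg_inv fg_mul.
Proof. by move=> u; apply: val_inj; exact: word_mulVw. Qed.
Lemma fg_mulgV : right_inverse fg_one fg_inv fg_mul.
Proof.
move=> u; apply: val_inj => /=; rewrite -{1}[val u]word_invK.
exact: word_mulVw.
Qed.

HB.instance Definition _ :=
  isGroup.Build free_group fg_mulA fg_mul1g fg_mulg1 fg_mulVg fg_mulgV.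

Definition fg_gen (x : X) : free_group := @FreeGroup [:: (x, false)] isT.

Section UniversalProperty.
Variables (G : groupType) (f : X -> G).

Definition letter_eval (a : letter) : G := if a.2 then (f a.1)^-1%g else f a.1.
Definition fg_lift (u : free_group) : G := (\prod_(a <- word_of u) letter_eval a)%g.

Lemma letter_evalV a : letter_eval (letter_inv a) = (letter_eval a)^-1%g.
Proof. by case: a => x [] /=; rewrite /letter_eval /= ?invgK. Qed.

Lemma prod_push a w :
  (\prod_(b <- push a w) letter_eval b =
   letter_eval a * \prod_(b <- w) letter_eval b)%g.
Proof.
case: w => [|b w] /=; first by rewrite big_cons.
case: eqP => [->|_]; rewrite !big_cons //.
by rewrite letter_evalV mulVKg.
Qed.

Lemma fg_liftM : {morph fg_lift : u v / (u * v)%g}.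
Proof.
move=> u v; rewrite /fg_lift /= /word_mul.
elim: (word_of u) => [|a w IHw] /=; first by rewrite big_nil mul1g.
by rewrite prod_push IHw big_cons mulgA.
Qed.

Lemma fg_lift_gen x : fg_lift (fg_gen x) = f x.
Proof. by rewrite /fg_lift big_seq1. Qed.

Lemma fg_lift_unique (g : {multiplicative free_group -> G}) :
  (forall x, g (fg_gen x) = f x) -> g =1 fg_lift.
Proof.
move=> gX [w rw]; elim: w rw => [|a w IHw] rw.
  rewrite /fg_lift big_nil; apply: (mulgI (g (FreeGroup rw))).
  by rewrite mulg1 -gmulfM; congr (g _); apply: val_inj.
have rw' := reduced_behead rw; rewrite /fg_lift big_cons.
have -> : FreeGroup rw = (@FreeGroup [:: a] isT * FreeGroup rw')%g.
  by apply: val_inj => /=; case: w rw {IHw rw'} => //= b w /andP[/negPf ->].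
rewrite gmulfM (IHw rw') /fg_lift; congr (_ * _)%g.
have g1 : g 1%g = 1%g by apply: (mulgI (g 1%g)); rewrite -gmulfM !mulg1.
case: a {rw IHw} => x []; last exact: gX; rewrite /letter_eval /= -gX.
apply: (mulgI (g (fg_gen x))); rewrite mulgV -gmulfM -g1; congr (g _).
by apply: val_inj; rewrite /= eqxx.
Qed.

End UniversalProperty.
End FreeGroup.

Section Groups.
Variable G : groupType.

Definition Aut_orbit (x : G) : set G :=
  [set y | exists f : {multiplicative G -> G}, bijective f /\ y = f x].

Definition normal_subgroup (R : groupClosed G) : Prop :=
  forall x y : G, y \in R -> (y ^ x)%g \in R.

(* s meets every left coset of R. *)
Definition finite_index (R : groupClosed G) : Prop :=
  exists s : seq G, forall x : G, exists2 y, y \in s & (y^-1 * x)%g \in R.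

Definition subgroup (R : groupClosed G) : Type := {x : G | x \in R}.

Variable R : groupClosed G.

HB.instance Definition _ := SubChoice.on (subgroup R).

Fact subgroup_closed : group_closed R.
Proof. by split=> [|x y xR yR]; [exact: gpred1 | exact: gpredF]. Qed.

HB.instance Definition _ :=
  SubChoice_isSubGroup.Build G (fun x => x \in R) (subgroup R) subgroup_closed.

End Groups.

Section LinearSpan.
Variables (K : nzRingType) (V : lmodType K).

Definition lspan (A : set V) : set V :=
  [set v | exists2 s : seq (K * V), (forall p, p \in s -> A p.2) &
     v = \sum_(p <- s) p.1 *: p.2].

Lemma lspan_submod (A : set V) : subsemimod_closed [pred v | v \in lspan A].
Proof.
do 2?split.
- by rewrite !inE; exists [::] => //; rewrite big_nil.
- move=> u v /set_mem[s As ->] /set_mem[t At ->]; apply/mem_set.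
  exists (s ++ t); last by rewrite big_cat.
  by move=> p; rewrite mem_cat => /orP[/As|/At].
- move=> c v /set_mem[s As ->]; apply/mem_set.
  exists [seq (c * p.1, p.2) | p <- s]; first by move=> p /mapP[q /As Aq ->].
  by rewrite big_map scaler_sumr; apply: eq_bigr => p _; rewrite scalerA.
Qed.

End LinearSpan.

(* Group homology in degree one, computed from the bar complex with trivial
   coefficients in rat. The chains in degree one are the free rat-module on G;
   they are all cycles, and the boundaries are spanned by
   d[x|y] = [y] - [x * y] + [x]. *)
Section FirstHomology.
Variable G : groupType.

Definition chain1 : Type := {freeg G / rat}.
HB.instance Definition _ := GRing.Lmodule.on chain1.

Definition chain1_of (x : G) : chain1 := << x >>.

Definition boundary2 (p : G * G) : chain1 :=
  chain1_of p.2 - chain1_of (p.1 * p.2)%g + chain1_of p.1.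

Definition boundaries1 : {pred chain1} :=
  [pred c | c \in lspan (range boundary2)].

HB.instance Definition _ :=
  GRing.isSubmodClosed.Build rat chain1 boundaries1 (lspan_submod _).

Definition H1 : Type := Quotient.quot boundaries1.
HB.instance Definition _ := GRing.Zmodule.on H1.

Definition chain1_class (c : chain1) : H1 := \pi_(Quotient.quot boundaries1) c.

Definition H1_scale (a : rat) (u : H1) : H1 := chain1_class (a *: repr u).

Lemma chain1_classP (c d : chain1) :
  (chain1_class c = chain1_class d) <-> c - d \in boundaries1.
Proof. by rewrite Quotient.idealrBE; split=> /eqP. Qed.

Lemma chain1_classD c d : chain1_class (c + d) = chain1_class c + chain1_class d.
Proof. by rewrite /chain1_class; exact: raddfD. Qed.

Lemma H1_scaleE a c : H1_scale a (chain1_class c) = chain1_class (a *: c).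
Proof.
apply/chain1_classP; rewrite -scalerBr; apply: rpredZ.
by apply/chain1_classP; exact: reprK.
Qed.

Lemma H1_ind (P : H1 -> Prop) : (forall c, P (chain1_class c)) -> forall u, P u.
Proof. by move=> Pc u; rewrite -[u]reprK. Qed.

Lemma H1_scalerA a b u : H1_scale a (H1_scale b u) = H1_scale (a * b) u.
Proof. by elim/H1_ind: u => c; rewrite !H1_scaleE scalerA. Qed.
Lemma H1_scale1r : left_id 1 H1_scale.
Proof. by elim/H1_ind => c; rewrite H1_scaleE scale1r. Qed.
Lemma H1_scalerDr : right_distributive H1_scale +%R.
Proof.
by move=> a; elim/H1_ind => c; elim/H1_ind => d;
   rewrite -chain1_classD !H1_scaleE -chain1_classD scalerDr.
Qed.
Lemma H1_scalerDl u : {morph H1_scale^~ u : a b / a + b}.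
Proof.
by move=> a b; elim/H1_ind: u => c; rewrite !H1_scaleE -chain1_classD scalerDl.
Qed.

HB.instance Definition _ := GRing.Zmodule_isLmodule.Build rat H1
  H1_scalerA H1_scale1r H1_scalerDr H1_scalerDl.

Definition H1_class (x : G) : H1 := chain1_class (chain1_of x).

Lemma H1_classM x y : H1_class (x * y)%g = H1_class x + H1_class y.
Proof.
rewrite /H1_class -chain1_classD; apply/esym/chain1_classP/mem_set.
exists [:: (1, boundary2 (x, y))].
  by move=> p; rewrite inE => /eqP -> /=; exists (x, y).
by rewrite big_seq1 scale1r /boundary2 /= [RHS]addrAC [in RHS](addrC (chain1_of y)).
Qed.

End FirstHomology.

Definition H1_power_span (G : groupType) (O : set G) (R : groupClosed G) :
    set (H1 (subgroup R)) :=
  lspan [set v | exists x k (xkR : (x ^+ k)%g \in R),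
    [/\ O x, (1 <= k)%N & v = H1_class (Sub (x ^+ k)%g xkR : subgroup R)]].

Arguments H1_power_span {G} O R.

(* Main.v *)
(** A finite-image representation [V] of [F_n] over the rationals in which no
    nontrivial element of [O] fixes a nonzero vector suffices.  Since [F_n] is
    free, a cocycle [c : F_n -> V] may be prescribed on the generators.  On the
    kernel [R] of the representation [c] is a homomorphism, and
    [c(x^k) = (1 + x + ... + x^(k-1)) c(x)] is fixed by [x], so [c] kills every
    [x^k] in [R] with [x] in [O].  If [c] killed all of [R] it would be
    determined modulo [R]; comparing [c(zh)] and [c(hz)] for a power [z] of a
    generator that is central modulo [R], has [c(z) = 0] and fixes no nonzero
    vector then gives [c = 0].

    For one orbit, take a large prime [p] and let [j] be the least degree of a
    nonzero term of [mu(x) - 1], where [mu] is the Magnus expansion modulo [p];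
    it depends only on the orbit, and [p] does not divide [j].  Put [d = p^j]
    and map the generators to [1 + a_i t] in the skew power series ring over
    the field with [p^d] elements, where [t a = a^p t], truncated after degree
    [d j].  For generic [a_i] every [y] in the orbit has image
    [1 + b t^j + ...] with [b <> 0], so [y^d] is mapped to
    [1 + nu t^(d j)], where [nu] is the norm of [b] to the prime field: a
    generator of one central subgroup [C] of order [p].  Functions on a finite
    set with sum zero on the [C]-orbits have no nonzero [C]-invariants.
    Different orbits are treated with different primes, and the function spaces
    are tensored.  *)

From HB Require Import structures.
Require Import Defs.
From mathcomp Require Import all_boot all_order all_algebra all_classical.
From mathcomp Require Import all_fingroup all_solvable all_field.
From mathcomp Require Import freeg zify.

Set Implicit Arguments.
Unset Strict Implicit.
Unset Printing Implicit Defensive.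

Import Order.TTheory GRing.Theory Num.Theory.

Local Open Scope ring_scope.

(** * Magnus coefficients *)

Section MagnusCoefficients.
Variable X : choiceType.
Implicit Types (f : seq X -> int) (I J : seq X) (w : seq (letter X)).

(* [mul_step i] and [div_step i] are multiplication by [1 + X_i] and by its
   inverse on noncommutative power series, given by their coefficients. *)
Definition mul_step (i : X) f I : int :=
  f I + (if I is k :: J then f J *+ (k == i) else 0).

Fixpoint div_step (i : X) f I : int :=
  f I - (if I is k :: J then div_step i f J *+ (k == i) else 0).

Definition letter_step (a : letter X) :=
  if a.2 then div_step a.1 else mul_step a.1.

Definition magnus_coef w : seq X -> int :=
  foldr letter_step (fun I => (I == [::])%:R) w.

Lemma div_stepK i f I : mul_step i (div_step i f) I = f I.
Proof. by case: I => [|k J]; rewrite /mul_step /= subrK. Qed.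

Lemma magnus_coef0 w : magnus_coef w [::] = 1.
Proof.
elim: w => //= a w IHw; rewrite /letter_step; case: a.2.
  by rewrite /= subr0.
by rewrite /mul_step addr0.
Qed.

(* The generators of the maximal blocks of letters with the same generator. *)
Fixpoint syllables w : seq X :=
  if w is a :: w' then
    let s := syllables w' in if ohead s == Some a.1 then s else a.1 :: s
  else [::].

Definition stutter_free I := sorted (fun a b => a != b) I.

Lemma stutter_free_behead i I : stutter_free (i :: I) -> stutter_free I.
Proof. exact: path_sorted. Qed.

(** Modulo [X_i ^ 2] the factor is [1 + X_i] or [1 - X_i], and the higher powers of [X_i] in the
    inverse only reach words with two equal adjacent generators. *)
Lemma magnus_coef_cons (a : letter X) w k J : stutter_free (k :: J) ->
  magnus_coef (a :: w) (k :: J) =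
  magnus_coef w (k :: J) + (-1) ^+ a.2 * magnus_coef w J *+ (k == a.1).
Proof.
move=> sf; rewrite /= /letter_step; case: a.2 => /=; last by rewrite mul1r.
case: eqP sf => [->|_] /= sf; last by rewrite !mulr0n oppr0.
rewrite mulr1n mulN1r; congr (_ - _).
case: J sf => [|l J] /=; first by rewrite subr0.
by rewrite eq_sym => /andP[/negPf -> _]; rewrite subr0.
Qed.

Arguments magnus_coef : simpl never.

Lemma magnus_coef_cons_neq (a : letter X) w J : stutter_free J ->
  ohead J != Some a.1 -> magnus_coef (a :: w) J = magnus_coef w J.
Proof.
case: J => [|k J] sf ne; first by rewrite !magnus_coef0.
rewrite magnus_coef_cons //; have /negPf -> : k != a.1.
  by apply: contraNneq ne => /= ->.
by rewrite addr0.
Qed.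

(** Each syllable contributes at most one letter to a stutter-free word. The second clause says that
    a first syllable which does not match the head of [J] contributes nothing; the induction needs
    it when a letter prolongs that syllable. *)
Lemma magnus_coef_vanish w J : stutter_free J ->
  ((size (syllables w) <= size J)%N -> J != syllables w ->
     magnus_coef w J = 0) /\
  (forall i S, syllables w = i :: S -> ohead J != Some i ->
     (size S <= size J)%N -> J != S -> magnus_coef w J = 0).
Proof.
elim: w J => [|a w IHw] J sf; first by split=> //; case: J sf.
split; last first.
  move=> i S /=; case: ifP => [hd eS|_ [<- <-]] hJ sz ne.
    have ia : i = a.1 by move: hd; rewrite eS => /eqP[].
    by rewrite [LHS]magnus_coef_cons_neq -?ia // (proj2 (IHw J sf) i S).
  by rewrite [LHS]magnus_coef_cons_neq // (proj1 (IHw J sf)).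
case: J sf => [|k J] sf /=.
  by case: ifP => // hd; case: (syllables w) hd => //.
move=> sz ne; rewrite [LHS]magnus_coef_cons //.
have sf' := stutter_free_behead sf.
have hJ : ohead J != Some k.
  by case: (J) sf => // l J' /= /andP[kl _]; apply: contraNneq kl => -[<-].
have [hd|hd] := boolP (ohead (syllables w) == Some a.1).
  rewrite hd in sz ne; rewrite (proj1 (IHw _ sf)) // add0r.
  have [ka|] := eqVneq k a.1; last by [].
  case eS : (syllables w) hd sz ne => [|i S] //= /eqP[ia] sz ne.
  rewrite (proj2 (IHw _ sf') i S) ?mulr0 ?mul0rn //.
    by rewrite ia -ka.
  by apply: contraNneq ne => ->; rewrite ka ia.
rewrite (negPf hd) /= in sz ne; rewrite (proj1 (IHw _ sf)); last 2 first.
- exact: leqW.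
- by apply: contraTneq sz => <-; rewrite -ltnNge.
rewrite add0r; have [ka|] := eqVneq k a.1; last by [].
rewrite (proj1 (IHw _ sf')) ?mulr0 ?mul0rn //.
by apply: contraNneq ne => <-; rewrite ka.
Qed.

Lemma syllables_stutter_free w : stutter_free (syllables w).
Proof.
elim: w => //= a w IHw; case: ifP => // /negbT hd.
case: (syllables w) IHw hd => //= k J -> hd; rewrite andbT.
by apply: contraNneq hd => ->.
Qed.

(* The coefficient of the word of syllables is the product of the exponents of
   the syllables, and its sign is tracked so that a letter prepended to the first
   syllable cannot make it vanish. *)
Lemma magnus_coef_syllables (a : letter X) w : reduced_word (a :: w) ->
  exists2 J, syllables (a :: w) = a.1 :: J &
    0 < (-1) ^+ a.2 * magnus_coef (a :: w) (a.1 :: J) * magnus_coef (a :: w) J.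
Proof.
elim: w a => [|b w IHw] a rw.
  exists [::] => //; rewrite magnus_coef_cons // !magnus_coef0 eqxx.
  by rewrite /magnus_coef /= add0r !mulr1 mulr1n -expr2 sqrr_sign.
have {IHw} [J eJ posJ] := IHw b (reduced_behead rw).
have := syllables_stutter_free (a :: b :: w).
rewrite [syllables (a :: _)]/= -/(syllables (b :: w)) eJ /=.
have [ab|nab] := eqVneq b.1 a.1.
  rewrite ab eqxx => sf; exists J => //.
  have nJ : ohead J != Some a.1.
    by case: (J) sf => // l J' /= /andP[kl _]; apply: contraNneq kl => -[<-].
  have ab2 : a.2 = b.2.
    move: rw => /= /andP[]; rewrite /letter_inv => ne _; apply/eqP.
    apply: contraNeq ne => ne; rewrite -ab.
    by case: (b) ne => ? [] /=; case: a.2.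
  have sfJ := stutter_free_behead sf.
  rewrite magnus_coef_cons // eqxx mulr1n.
  rewrite (magnus_coef_cons_neq (b :: w) sfJ nJ) ab2; move: posJ; rewrite ab.
  set x := magnus_coef _ (_ :: _); set y := magnus_coef _ _.
  rewrite mulrDr mulrA -expr2 sqrr_sign mul1r mulrDl => posJ.
  by apply: ltr_wpDr => //; rewrite -expr2 sqr_ge0.
case: eqP => [[ab]|_]; first by rewrite ab eqxx in nab.
move=> sf; exists (b.1 :: J) => //.
have sfJ := stutter_free_behead sf.
rewrite magnus_coef_cons // eqxx mulr1n.
rewrite (magnus_coef_cons_neq (b :: w) sfJ) //=.
rewrite (proj1 (magnus_coef_vanish (b :: w) sf)) ?eJ //; last first.
  by apply: contraNneq nab => -[->].
rewrite add0r mulrA -expr2 sqrr_sign mul1r -expr2 exprn_even_gt0 //=.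
by apply: contraTneq posJ => ->; rewrite mulr0 mul0r ltxx.
Qed.

Lemma magnus_coef_neq0 w : reduced_word w -> w != [::] ->
  exists2 I, I != [::] & magnus_coef w I != 0.
Proof.
case: w => // a w /magnus_coef_syllables[J _ pos] _.
exists (a.1 :: J) => //; apply: contraTneq pos => ->.
by rewrite mulr0 mul0r ltxx.
Qed.

End MagnusCoefficients.

(** * Evaluation of Magnus series at nilpotent elements *)

Section MagnusEvaluation.
Variables (X : finType) (A : finUnitRingType) (u : X -> {unit A}).
Let N i : A := val (u i) - 1.
Implicit Types (f g : seq X -> int) (I J : seq X).

(* The series with coefficients [f] at [X_i := N i], cut at degree [t]. *)
Fixpoint magnus_eval t f : A :=
  if t is t'.+1 then
    (f [::])%:~R + \sum_i N i * magnus_eval t' (fun I => f (i :: I))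
  else 0.

Lemma eq_magnus_eval t f g : f =1 g -> magnus_eval t f = magnus_eval t g.
Proof.
elim: t f g => //= t IHt f g fg; rewrite fg; congr (_ + _).
by apply: eq_bigr => i _; congr (_ * _); apply: IHt => I; rewrite fg.
Qed.

Arguments eq_magnus_eval {t f} g.

Lemma magnus_evalD t f g :
  magnus_eval t (fun I => f I + g I) = magnus_eval t f + magnus_eval t g.
Proof.
elim: t f g => [|t IHt] f g /=; first by rewrite addr0.
rewrite rmorphD addrACA -big_split /=; congr (_ + _).
by apply: eq_bigr => i _; rewrite IHt mulrDr.
Qed.

Lemma magnus_eval0 t : magnus_eval t (fun=> 0) = 0.
Proof.
elim: t => //= t IHt; rewrite add0r big1 // => i _.
by rewrite IHt mulr0.
Qed.

Definition word_prod I : A := \prod_(i <- I) N i.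

Variable M : nat.
Hypothesis nilN : forall I, size I = M -> word_prod I = 0.

(** The terms gained by one more degree, multiplied by [word_prod I], are products of [M] factors
    [N i]. *)
Lemma magnus_eval_trunc I t f : (size I + t)%N = M ->
  word_prod I * magnus_eval t.+1 f = word_prod I * magnus_eval t f.
Proof.
elim: t I f => [|t IHt] I f; first by rewrite addn0 => /nilN ->; rewrite !mul0r.
move=> sz; rewrite [magnus_eval t.+2 _]/= [magnus_eval t.+1 _]/= !mulrDr.
congr (_ + _); rewrite !mulr_sumr; apply: eq_bigr => i _.
have := IHt (rcons I i) (fun J => f (i :: J)).
by rewrite size_rcons addSnnS /word_prod big_rcons /= -!mulrA; apply.
Qed.

Lemma magnus_eval_mul i f : (0 < M)%N ->
  magnus_eval M (mul_step i f) = val (u i) * magnus_eval M f.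
Proof.
move=> M0; rewrite -[val (u i)](subrK 1) mulrDl mul1r addrC -/(N i).
case: M (magnus_eval_trunc (I := [:: i])) M0 => // t trunc _.
rewrite /mul_step magnus_evalD; congr (_ + _) => /=.
rewrite add0r (bigD1 i) //= big1 => [|k /negPf ki].
  rewrite addr0 (eq_magnus_eval (f)) => [|I]; last by rewrite eqxx.
  by have := trunc t f erefl; rewrite /word_prod big_seq1 => <-.
rewrite (eq_magnus_eval (fun=> 0)) ?magnus_eval0 ?mulr0 // => I.
by rewrite ki.
Qed.

Lemma magnus_eval_coef (w : free_group X) : (0 < M)%N ->
  val (fg_lift u w) = magnus_eval M (magnus_coef w).
Proof.
move=> M0; case: w => w rw; rewrite /fg_lift /= {rw}.
elim: w => [|a w IHw].
  rewrite big_nil; case: M M0 => //= t _; rewrite big1 ?addr0 // => i _.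
  by rewrite (eq_magnus_eval (fun=> 0)) ?magnus_eval0 ?mulr0.
transitivity (val (letter_eval u a) * magnus_eval M (magnus_coef w)).
  by rewrite big_cons -IHw; exact: FinRing.val_unitM.
rewrite /magnus_coef /= -/(magnus_coef w).
case: a => i b; rewrite /letter_eval /letter_step /=; case: b => /=; last first.
  by rewrite magnus_eval_mul.
rewrite (eq_magnus_eval (mul_step i (div_step i (magnus_coef w)))).
  by rewrite magnus_eval_mul // mulKr //; exact: valP.
by move=> I; rewrite div_stepK.
Qed.

End MagnusEvaluation.

(** * Unitriangular representations *)

Section BandedMatrices.
Variables (K : nzRingType) (m : nat).
Implicit Types A B : 'M[K]_m.+1.

(** The matrix counterpart of power series of order at least [k]. *)
Definition banded k A := forall i j : 'I_m.+1, (j < i + k)%N -> A i j = 0.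

Lemma banded_le k l A : (k <= l)%N -> banded l A -> banded k A.
Proof. by move=> kl Al i j ij; apply: Al; lia. Qed.

Lemma banded0 k : banded k 0.
Proof. by move=> i j _; rewrite mxE. Qed.

Lemma bandedD k A B : banded k A -> banded k B -> banded k (A + B).
Proof. by move=> Ak Bk i j ij; rewrite mxE Ak ?Bk ?addr0. Qed.

Lemma bandedM k l A B : banded k A -> banded l B -> banded (k + l) (A * B).
Proof.
move=> Ak Bl i j ij; rewrite mxE big1 // => h _.
by have [ih|hi] := ltnP h (i + k);
  [rewrite Ak ?mul0r | rewrite Bl ?mulr0 //; lia].
Qed.

Lemma banded_scalar c : banded 0 (c%:M : 'M_m.+1).
Proof.
by move=> i j ij; rewrite mxE -val_eqE /= gtn_eqF //; lia.
Qed.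

Lemma banded_eq0 k A : (m < k)%N -> banded k A -> A = 0.
Proof.
move=> mk Ak; apply/matrixP=> i j; rewrite Ak ?mxE //.
by have := ltn_ord j; lia.
Qed.

Lemma banded_prod (I : Type) (r : seq I) (F : I -> 'M_m.+1) :
  (forall i, banded 1 (F i)) -> banded (size r) (\prod_(i <- r) F i).
Proof.
move=> F1; elim: r => [|i r IHr]; first by rewrite big_nil; apply: banded_scalar.
by rewrite big_cons /= -add1n; apply: bandedM.
Qed.

Lemma banded_exp k A t : banded k A -> banded (t * k) (A ^+ t).
Proof.
move=> Ak; elim: t => [|t IHt]; first exact: banded_scalar.
by rewrite exprS mulSn; apply: bandedM.
Qed.

Lemma bandedM_entry k l A B (i h j : 'I_m.+1) : banded k A -> banded l B ->
  h = (i + k)%N :> nat -> j = (h + l)%N :> nat -> (A * B) i j = A i h * B h j.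
Proof.
move=> Ak Bl eh ej; rewrite mxE (bigD1 h) //= big1 ?addr0 // => g gh.
have [ig|gi] := ltnP g (i + k); first by rewrite Ak ?mul0r.
rewrite Bl ?mulr0 //.
have : g != h :> nat by [].
lia.
Qed.

End BandedMatrices.

Section UnitriangularEvaluation.
Variables (X : finType) (K : finFieldType) (m : nat) (u : X -> {unit 'M[K]_m.+1}).
Implicit Types (f : seq X -> int) (I : seq X).
Let N i : 'M[K]_m.+1 := val (u i) - 1.
Hypothesis N1 : forall i, banded 1 (N i).

Let nilN I : size I = m.+1 -> word_prod u I = 0.
Proof.
by move=> sz; apply: (@banded_eq0 _ _ (size I)); [rewrite sz | exact: banded_prod].
Qed.

Lemma intr_mx (z : int) : z%:~R = (z%:~R)%:M :> 'M[K]_m.+1.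
Proof. by rewrite -scalemx1 scaler_int. Qed.

Lemma banded_magnus_eval k t f :
  (forall I, (size I < k)%N -> (f I)%:~R = 0 :> K) ->
  banded k (magnus_eval u t f).
Proof.
elim: t k f => [|t IHt] [|k] f f0 /=; do ?exact: banded0.
  apply: bandedD; first by rewrite intr_mx; apply: banded_scalar.
  apply: (big_ind (banded 0)) => [|A B|i _]; [exact: banded0 | exact: bandedD |].
  by apply: (banded_le (l := 1 + 0)) => //; apply: (bandedM (N1 i)); apply: IHt.
rewrite intr_mx f0 // raddf0 add0r.
apply: (big_ind (banded k.+1)) => [|A B|i _]; [exact: banded0 | exact: bandedD |].
by rewrite -add1n; apply: (bandedM (N1 i)); apply: IHt => I sz; apply: f0.
Qed.

Lemma banded_lift k (w : free_group X) : (0 < k)%N ->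
  (forall I, (0 < size I < k)%N -> (magnus_coef w I)%:~R = 0 :> K) ->
  banded k (val (fg_lift u w) - 1).
Proof.
move=> k0 w0; rewrite (magnus_eval_coef nilN) //.
rewrite /= magnus_coef0 [X in X - 1]addrC addrK.
apply: (big_ind (banded k)) => [|A B|i _]; [exact: banded0 | exact: bandedD |].
case: k k0 w0 => // k _ w0; rewrite -add1n; apply: (bandedM (N1 i)).
by apply: banded_magnus_eval => I sz; apply: w0.
Qed.

Lemma banded1_lift (w : free_group X) : banded 1 (val (fg_lift u w) - 1).
Proof. by apply: banded_lift => // I; case: (size I). Qed.

Variable a : X -> nat -> K.
Hypothesis NE : forall i (r s : 'I_m.+1), N i r s = a i r *+ (s == r.+1 :> nat).

(* The sum over the words of length [l] of their coefficient times
   [a i_0 r * a i_1 r.+1 * ...]: the entry [l] places right of the diagonal in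
   row [r] when [N i] has the entries [a i] on the first superdiagonal. *)
Fixpoint path_sum l r f : K :=
  if l is l'.+1 then \sum_i a i r * path_sum l' r.+1 (fun I => f (i :: I))
  else (f [::])%:~R.

(** Each [N i] moves exactly one place to the right, so only words of length [l] reach the entry
    [(r, r + l)]. *)
Lemma magnus_eval_entry l t f (r s : 'I_m.+1) : (l < t)%N ->
  s = (r + l)%N :> nat -> magnus_eval u t f r s = path_sum l r f.
Proof.
elim: t l f r => // t IHt l f r lt es.
rewrite /= mxE intr_mx mxE summxE -val_eqE /= es.
case: l lt es => [|l] lt es /=.
  rewrite addn0 eqxx mulr1n big1 ?addr0 // => i _.
  rewrite mxE big1 // => h _; rewrite NE.
  have [hr|] := eqVneq; last by rewrite mulr0n mul0r.
  by rewrite (@banded_magnus_eval 0 t _ _ h s) ?mulr0 //; lia.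
rewrite -[X in X == _]addn0 eqn_add2l mulr0n add0r; apply: eq_bigr => i _.
have rm : (r.+1 < m.+1)%N by have := ltn_ord s; lia.
rewrite mxE (bigD1 (Ordinal rm)) //= big1 => [|h hr].
  by rewrite NE eqxx addr0 (IHt l) //= es addSnnS.
rewrite NE; have /negPf -> : h != r.+1 :> nat by [].
by rewrite mulr0n mul0r.
Qed.

Lemma lift_entry l (w : free_group X) (r s : 'I_m.+1) :
  s = (r + l)%N :> nat ->
  val (fg_lift u w) r s = path_sum l r (magnus_coef w).
Proof.
move=> es; rewrite (magnus_eval_coef nilN) // (@magnus_eval_entry l) //.
by have := ltn_ord s; lia.
Qed.

End UnitriangularEvaluation.

Section Unitriangular.
Variables (K : finFieldType) (m : nat).

Definition superdiag (a : nat -> K) : 'M[K]_m.+1 :=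
  \matrix_(r, s) (a r *+ (s == r.+1 :> nat)).

Lemma banded_superdiag a : banded 1 (superdiag a).
Proof. by move=> i j ij; rewrite mxE; have /negPf -> : j != i.+1 :> nat by lia. Qed.

Lemma banded1_unit (N : 'M[K]_m.+1) : banded 1 N -> 1 + N \is a GRing.unit.
Proof.
move=> N1; have N0 : (- N) ^+ m.+1 = 0.
  apply: (@banded_eq0 _ _ (m.+1 * 1)); first by rewrite muln1.
  by apply: banded_exp => i j /N1 Nij; rewrite mxE Nij oppr0.
have := subrX1 (- N) m.+1; rewrite N0 sub0r => e.
have : (1 + N) * (\sum_(i < m.+1) (- N) ^+ i) = 1.
  by rewrite -[1 + N]opprK opprD mulNr [- 1 - N]addrC -e opprK.
by case/mulmx1_unit.
Qed.

Definition unitri (a : nat -> K) : {unit 'M[K]_m.+1} :=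
  FinRing.unit _ (banded1_unit (banded_superdiag a)).

Lemma unitriE a : val (unitri a) - 1 = superdiag a.
Proof. by rewrite /= addrC addKr. Qed.

End Unitriangular.

Section DegreeInvariance.
Variables (X : finType) (K : finFieldType).

(** These weights are the indicator of reading the letters of [I] in order, so a single word
    survives. *)
Lemma path_sum_word (I : seq X) J r (f : seq X -> int) : drop r I = J ->
  path_sum (fun i r => (onth I r == Some i)%:R : K) (size J) r f = (f J)%:~R.
Proof.
elim: J r f => [|j J IHJ] r f eJ //=.
have rI : (r < size I)%N by rewrite ltnNge -subn_eq0 -size_drop eJ.
have eI : onth I r = Some j /\ drop r.+1 I = J.
  move: eJ; rewrite (drop_nth j rI) => -[<- <-]; split=> //.
  by rewrite onthE (nth_map j).
rewrite (bigD1 j) //= eI.1 eqxx mul1r IHJ ?eI.2 // big1 ?addr0 // => i ij.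
by rewrite (inj_eq Some_inj) eq_sym (negPf ij) mul0r.
Qed.

(* The coefficient of [I] is an entry of a unitriangular representation of
   size [size I + 1], and vanishing of all coefficients of length at most
   [size I] means triviality in all such representations. *)
Lemma magnus_coef_endo (f : {multiplicative free_group X -> free_group X}) k
    (w : free_group X) :
  (forall I, (0 < size I < k)%N -> (magnus_coef w I)%:~R = 0 :> K) ->
  forall I, (0 < size I < k)%N -> (magnus_coef (f w) I)%:~R = 0 :> K.
Proof.
move=> w0 I sI.
pose u i := unitri (size I) (fun r => (onth I r == Some i)%:R : K).
(* Precomposition with [f] gives another unitriangular representation; its generators may leave the
   first superdiagonal, but [banded_lift] asks only for [banded 1]. *)
pose v i := fg_lift u (f (fg_gen i)).
have u1 i : banded 1 (val (u i) - 1) by rewrite unitriE; apply: banded_superdiag.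
have v1 i : banded 1 (val (v i) - 1) by apply: banded1_lift.
have fw : fg_lift u (f w) = fg_lift v w.
  pose g := fg_lift u \o f.
  have gM : {morph g : x y / (x * y)%g}.
    by move=> x y; rewrite /g /= gmulfM fg_liftM.
  pose gm := isMultiplicative.Build _ _ g gM.
  pose G : {multiplicative free_group X -> {unit 'M[K]_((size I).+1)}} := HB.pack g gm.
  exact: (@fg_lift_unique _ _ v G).
have -> : (magnus_coef (f w) I)%:~R = val (fg_lift u (f w)) ord0 ord_max :> K.
  rewrite (@lift_entry _ _ _ _ u1
     (fun i r => (onth I r == Some i)%:R) _ (size I)) //.
    by rewrite path_sum_word // drop0.
  by move=> i r s; rewrite unitriE mxE.
rewrite fw.
have bw : banded (size I).+1 (val (fg_lift v w) - 1).
  apply: banded_lift => // J /andP[J0 JI]; apply: w0; rewrite J0 /=.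
  by apply: (leq_trans JI); case/andP: sI.
have /subr0_eq -> := banded_eq0 (ltnSn _) bw.
by rewrite mxE -val_eqE /=; case: (size I) sI.
Qed.

End DegreeInvariance.

(** * Generic path sums over a finite field *)

(** A generator of the cyclic unit group works: [2 < p] keeps each exponent [p ^ r], [r < d], below
    the order [p ^ d - 1], even for [d = 1]. *)
Lemma exists_distinct_conjugates (K : finFieldType) p d :
  (2 < p)%N -> #|K| = (p ^ d)%N ->
  exists x : K, {in gtn d &, injective (fun r => x ^+ (p ^ r))}.
Proof.
move=> p2 cK; have /cyclicP[u ugen] := field_unit_group_cyclic [set: {unit K}].
have ou : #[u]%g = (p ^ d).-1 by rewrite /order -ugen card_finField_unit cK.
exists (val u) => r s; rewrite !inE /= => rd sd e.
have /eqP : (u ^+ (p ^ r) = u ^+ (p ^ s))%g.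
  by apply: val_inj; rewrite !FinRing.val_unitX.
have small t : (t < d)%N -> (p ^ t < (p ^ d).-1)%N.
  case: d rd {cK ou sd} => // d _ td.
  have : (p ^ t <= p ^ d)%N by rewrite leq_exp2l //; lia.
  have := expn_gt0 p d; rewrite expnS; nia.
rewrite eq_expg_mod_order ou !modn_small ?small // eqn_exp2l => [/eqP //|].
exact: ltnW.
Qed.

Section GenericPathSum.
Variables (n p : nat) (K : finFieldType).
Hypotheses (np : (n <= p)%N) (pK : p \in [pchar K]).
Implicit Types (f : seq 'I_n -> int) (I : seq 'I_n).
Let p_gt0 : (0 < p)%N := prime_gt0 (pcharf_prime pK).

(* The entry in row [r] of the matrix of [x ^ i t] in the skew power series ring
   acting on the powers of [t], where [t] acts on scalars by Frobenius. *)
Definition conj_power (x : K) (i : 'I_n) r : K := x ^+ (i * p ^ r).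

(** The path sum with weights [conj_power x], as a polynomial in [x]; moving to the next row
    substitutes ['X^p]. *)
Fixpoint path_poly l f : {poly K} :=
  if l is l'.+1 then
    \sum_(i < n) 'X^i * (path_poly l' (fun I => f (i :: I)) \Po 'X^p)
  else ((f [::])%:~R)%:P.

Lemma size_path_poly l f : (size (path_poly l f) <= p ^ l)%N.
Proof.
elim: l f => [|l IHl] f /=; first exact: size_polyC_leq1.
apply: (leq_trans (size_sum _ _ _)); apply/bigmax_leqP => i _.
apply: (leq_trans (size_polyMleq _ _)); rewrite size_polyXn /=.
apply: (leq_trans (leq_add (leqnn _) (size_comp_poly_leq _ _))).
rewrite size_polyXn /= addnS /= expnS.
have : ((size (path_poly l (fun I => f (i :: I)))).-1 < p ^ l)%N.
  by have := IHl (fun I => f (i :: I)); have := expn_gt0 p l; rewrite p_gt0; lia.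
have := ltn_ord i; move: (size _).-1 => a; nia.
Qed.

(* As [n <= p], a word is the list of base [p] digits of an exponent, so distinct
   words contribute distinct monomials to [path_poly]. *)
Fixpoint digits_value I : nat :=
  if I is i :: I' then i + p * digits_value I' else 0.

Lemma coef_path_poly I f :
  (path_poly (size I) f)`_(digits_value I) = (f I)%:~R.
Proof.
elim: I f => [|i I IHI] f /=; first by rewrite coefC eqxx.
rewrite coef_sum (bigD1 i) //= big1 => [|k ki].
  rewrite coefXnM ltnNge leq_addr /= addKn coef_comp_poly_Xn //.
  by rewrite dvdn_mulr // mulKn // IHI addr0.
rewrite coefXnM coef_comp_poly_Xn //; case: ifP => // lt.
case: ifP => // /dvdnP[q eq]; have lk := ltn_ord k; have li := ltn_ord i.
have : (digits_value I * p + i)%N = (q * p + k)%N by lia.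
move=> /(congr1 (modn^~ p)); rewrite !modnMDl !modn_small; try lia.
by move=> /val_inj ik; rewrite ik eqxx in ki.
Qed.

Lemma horner_path_poly (x : K) l r f :
  (path_poly l f).[x ^+ (p ^ r)] = path_sum (conj_power x) l r f.
Proof.
elim: l r f => [|l IHl] r f /=; first by rewrite hornerC.
rewrite horner_sum; apply: eq_bigr => i _.
by rewrite hornerM horner_comp !hornerXn -!exprM -expnSr IHl /conj_power mulnC.
Qed.

(** Frobenius fixes the integer coefficients and moves the weights down one row. *)
Lemma path_sum_Frobenius (x : K) l r f :
  path_sum (conj_power x) l r f =
  (path_sum (conj_power x) l 0 f) ^+ (p ^ r).
Proof.
elim: r => [|r IHr]; first by rewrite expr1.
rewrite expnSr exprM -{}IHr -(pFrobenius_autE pK).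
elim: l r f => [|l IHl] r f /=; first by rewrite pFrobenius_aut_int.
rewrite rmorph_sum; apply: eq_bigr => i _.
rewrite rmorphM /= -IHl pFrobenius_autE /conj_power -exprM.
by rewrite -mulnA -expnSr.
Qed.

(** A zero at [x] would be a zero at all [d] conjugates of [x], too many for a nonzero polynomial of
    degree less than [p ^ l]. *)
Lemma path_sum_neq0 (x : K) d l I f :
  {in gtn d &, injective (fun r => x ^+ (p ^ r))} -> (p ^ l <= d)%N ->
  size I = l -> (f I)%:~R != 0 :> K ->
  path_sum (conj_power x) l 0 f != 0.
Proof.
move=> injx ld sI; apply: contraNneq => f0.
suff /eqP Q0 : path_poly l f == 0 by rewrite -coef_path_poly sI Q0 coef0.
apply: contraTT ld => Q0; rewrite -ltnNge.
have uq : uniq [seq x ^+ (p ^ r) | r <- iota 0 d].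
  rewrite map_inj_in_uniq ?iota_uniq // => r s; rewrite !mem_iota /=.
  exact: injx.
have := max_poly_roots Q0 _ uq.
rewrite size_map size_iota => /(_ _)/leq_trans; apply; last exact: size_path_poly.
apply/allP => _ /mapP[r _ ->].
by rewrite rootE horner_path_poly path_sum_Frobenius f0 expr0n expn_eq0 gtn_eqF.
Qed.

End GenericPathSum.

(** * Central powers *)

Lemma intr_eq0_pchar (R : nzRingType) p (z : int) : p \in [pchar R] ->
  (z%:~R == 0 :> R) = (p %| `|z|)%N.
Proof.
move=> pR; case: z => k; first by rewrite (dvdn_pcharf pR).
by rewrite NegzE rmorphN oppr_eq0 abszN (dvdn_pcharf pR).
Qed.

Section CharacteristicP.
Variables (p : nat) (K : fieldType).
Hypothesis pK : p \in [pchar K].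

Lemma expr_pexpn_comm_add (R : nzRingType) (x y : R) e :
  p \in [pchar R] -> GRing.comm x y ->
  (x + y) ^+ (p ^ e) = x ^+ (p ^ e) + y ^+ (p ^ e).
Proof.
move=> pR cxy; elim: e => [|e IHe]; first by rewrite !expr1.
rewrite expnSr !exprM IHe -!(pFrobenius_autE pR) pFrobenius_autD_comm //.
by apply: commrX; apply: commr_sym; apply: commrX; apply: commr_sym.
Qed.

Lemma Frobenius_fixed (x : K) : x ^+ p = x -> exists2 i, (i < p)%N & x = i%:R.
Proof.
move=> xp; have p_pr := pcharf_prime pK; have p1 := prime_gt1 p_pr.
pose s : seq K := [seq i%:R | i <- iota 0 p].
suff /mapP[i] : x \in s by rewrite mem_iota => /andP[_ ip] ->; exists i.
apply: contraT => xs.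
have us : uniq (x :: s).
  rewrite /= xs map_inj_in_uniq ?iota_uniq // => i j; rewrite !mem_iota /=.
  wlog ij : i j / (i <= j)%N.
    move=> wl ip jp e; have [le|/ltnW le] := leqP i j; first exact: wl.
    by apply/esym; apply: wl.
  move=> ip jp /esym/eqP; rewrite -subr_eq0 -natrB // -(dvdn_pcharf pK) => dv.
  by move: dv; rewrite /dvdn modn_small; lia.
have sz : size ('X^p - 'X : {poly K}) = p.+1.
  by rewrite size_polyDl size_polyXn // size_polyN size_polyX.
have := @max_poly_roots K ('X^p - 'X) (x :: s) _ _ us.
rewrite sz /= size_map size_iota ltnn => -> //.
  by rewrite -size_poly_eq0 sz.
apply/andP; split; first by rewrite rootE !hornerE xp subrr.
apply/allP => _ /mapP[i _ ->].
by rewrite rootE !hornerE -(pFrobenius_autE pK) pFrobenius_aut_nat subrr.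
Qed.

Lemma coprime_Frobenius_fixed (x : K) a b :
  coprime a b -> (0 < a)%N -> x ^+ (p ^ a) = x -> x ^+ (p ^ b) = x -> x ^+ p = x.
Proof.
move=> ab a0 xa xb.
have iterf c t : x ^+ (p ^ c) = x -> x ^+ (p ^ (t * c)) = x.
  by move=> xc; elim: t => // t IHt; rewrite mulSn expnD exprM xc.
case: (egcdnP b a0) => u v e _; move: e; rewrite (eqP ab) => e.
by rewrite -[in RHS](iterf a u xa) e expnD exprM iterf // expn1.
Qed.

End CharacteristicP.

(** The coefficient of [t ^ (d j)] in [(b t ^ j) ^ d], where [t a = a ^ p t]. *)
Definition twisted_norm (K : nzRingType) p j d (b : K) :=
  \prod_(i < d) b ^+ (p ^ (i * j)).

Section SuperdiagonalPower.
Variables (p : nat) (K : finFieldType) (j m : nat) (B : 'M[K]_m.+1) (b : K).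
Hypothesis Bj : banded j B.
Hypothesis BE :
  forall r s : 'I_m.+1, s = (r + j)%N :> nat -> B r s = b ^+ (p ^ r).

Lemma superdiag_exp t (r s : 'I_m.+1) : s = (r + t * j)%N :> nat ->
  (B ^+ t) r s = \prod_(i < t) b ^+ (p ^ (r + i * j)).
Proof.
elim: t s => [|t IHt] s es.
  by rewrite expr0 big_ord0 mxE -val_eqE /= es addn0 eqxx.
have hm : (r + t * j < m.+1)%N by have := ltn_ord s; rewrite es mulSn; lia.
rewrite exprSr (@bandedM_entry _ _ (t * j) j _ _ r (Ordinal hm)) //=; last first.
- by rewrite es mulSn /=; lia.
- exact: banded_exp.
rewrite (IHt (Ordinal hm)) // BE; first by rewrite big_ord_recr.
by rewrite es mulSn /=; lia.
Qed.

(* [B ^+ d] is banded at distance [d * j = m], so only its corner survives. *)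
Lemma exp_superdiag d : m = (d * j)%N ->
  B ^+ d = twisted_norm p j d b *: delta_mx ord0 ord_max.
Proof.
move=> mjd; apply/matrixP=> r s; rewrite !mxE.
have [/andP[/eqP -> /eqP ->]|] := boolP ((r == ord0) && (s == ord_max)).
  by rewrite mulr1 superdiag_exp //= mjd.
move=> rs; rewrite mulr0 (banded_exp (t := d) Bj) //.
move: rs; rewrite -!val_eqE /= -mjd; have := ltn_ord r; have := ltn_ord s.
lia.
Qed.

End SuperdiagonalPower.

(* [j] is invertible modulo [d], so this is the norm to the prime field. *)
Lemma twisted_norm_natr (K : finFieldType) p j d (b : K) :
    p \in [pchar K] -> #|K| = (p ^ d)%N -> (0 < j)%N -> coprime j d -> b != 0 ->
  exists2 i, coprime p i & twisted_norm p j d b = i%:R.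
Proof.
move=> pK cK j0 jd b0.
have Fd (x : K) : x ^+ (p ^ d) = x by rewrite -cK expf_card.
have Fdt (x : K) t : x ^+ (p ^ (d * t)) = x.
  by elim: t => [|t IHt]; rewrite ?muln0 ?expr1 // mulnS expnD exprM Fd.
(* The power [p ^ j] permutes the factors cyclically because [b ^ (p ^ (d * j)) = b]. *)
have Fj : twisted_norm p j d b ^+ (p ^ j) = twisted_norm p j d b.
  apply: (mulfI b0); rewrite /twisted_norm -prodrXl.
  transitivity (\prod_(i < d.+1) b ^+ (p ^ (i * j))).
    rewrite big_ord_recl mul0n expr1; congr (_ * _).
    by apply: eq_bigr => i _; rewrite -exprM -expnD addnC -mulSn.
  by rewrite big_ord_recr /= Fdt mulrC.
have /(Frobenius_fixed pK)[i ip e] : twisted_norm p j d b ^+ p = twisted_norm p j d b.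
  exact: (coprime_Frobenius_fixed jd).
exists i => //; rewrite prime_coprime ?(pcharf_prime pK) // (dvdn_pcharf pK) -e.
by rewrite prodf_seq_neq0; apply/allP => k _; rewrite expf_neq0.
Qed.

(* [ca_rot] is a permutation of order dividing [p], commuting with an action of
   [G] through a [p]-group. *)
Record cyclic_action (G : groupType) (p : nat) := CyclicAction {
  ca_type : finType;
  ca_act : G -> ca_type -> ca_type;
  ca_rot : ca_type -> ca_type;
  ca_exp : nat;
  ca_act1 : ca_act 1%g =1 id;
  ca_actM : forall g h, ca_act (g * h)%g =1 ca_act g \o ca_act h;
  ca_actX : forall g, ca_act (g ^+ (p ^ ca_exp))%g =1 id;
  ca_act_rot : forall g t, ca_act g (ca_rot t) = ca_rot (ca_act g t);
  ca_rotX : iter p ca_rot =1 id;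
  ca_rot_neq : exists t, ca_rot t != t }.

Arguments ca_act {G p} c.
Arguments ca_rot {G p} c.
Arguments ca_act1 {G p} c.
Arguments ca_actM {G p} c.
Arguments ca_actX {G p} c.
Arguments ca_act_rot {G p} c.
Arguments ca_rotX {G p} c.
Arguments ca_rot_neq {G p} c.

(** * Cyclic actions on column vectors, with a central transvection as rotation *)

Section UnitriangularAction.
Variables (X : finType) (p m : nat) (K : finFieldType) (u : X -> {unit 'M[K]_m.+1}).
Hypotheses (m0 : (0 < m)%N) (pK : p \in [pchar K]).
Hypothesis u1 : forall i, banded 1 (val (u i) - 1).
Let p_gt1 : (1 < p)%N := prime_gt1 (pcharf_prime pK).
Let E : 'M[K]_m.+1 := delta_mx ord0 ord_max.

Let pM : p \in [pchar 'M[K]_m.+1].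
Proof. by rewrite pchar_lalg. Qed.

Lemma val_lift1 : val (fg_lift u 1%g) = 1.
Proof. by rewrite /fg_lift big_nil. Qed.

Lemma val_liftM g h :
  val (fg_lift u (g * h)%g) = val (fg_lift u g) * val (fg_lift u h).
Proof. by rewrite fg_liftM; exact: FinRing.val_unitM. Qed.

Lemma val_liftX g k : val (fg_lift u (g ^+ k)%g) = val (fg_lift u g) ^+ k.
Proof.
elim: k => [|k IHk]; first by rewrite expr0; exact: val_lift1.
by rewrite expgS exprS val_liftM IHk.
Qed.

Lemma banded_corner : banded m E.
Proof.
move=> i j ij; rewrite mxE -!val_eqE /=; case: eqP => //= i0.
by case: eqP => // jm; move: ij; rewrite i0 jm ltnn.
Qed.

Lemma mul_corner_banded (B : 'M[K]_m.+1) : banded 1 B -> E * B = 0 /\ B * E = 0.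
Proof.
move=> B1; split.
  by apply: (@banded_eq0 _ _ (m + 1)); [lia | apply: bandedM banded_corner B1].
by apply: (@banded_eq0 _ _ (1 + m)); [lia | apply: bandedM B1 banded_corner].
Qed.

Lemma corner_comm g : val (fg_lift u g) * (1 + E) = (1 + E) * val (fg_lift u g).
Proof.
have [EB BE] := mul_corner_banded (banded1_lift u1 g).
rewrite mulrDr mulrDl mulr1 mul1r; congr (_ + _).
move: EB BE; rewrite mulrBl mulrBr mul1r mulr1 => /subr0_eq -> /subr0_eq ->.
by [].
Qed.

Lemma corner_exp k : (1 + E) ^+ k = 1 + k%:R *: E.
Proof.
have EE : E * E = 0 by rewrite [LHS]mul_delta_mx_0 // -val_eqE /= gtn_eqF.
elim: k => [|k IHk]; first by rewrite expr0 scale0r addr0.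
rewrite exprSr IHk mulrDl mul1r mulrDr mulr1 -scalerAl EE scaler0 addr0.
by rewrite -addrA -natr1 scalerDl scale1r [E + _]addrC.
Qed.

(** In characteristic [p] the power of [1 + B] is [1 + B ^ (p ^ m.+1)], and [B] is strictly upper
    triangular of size [m.+1]. *)
Lemma val_lift_pexpn g : val (fg_lift u (g ^+ (p ^ m.+1))%g) = 1.
Proof.
rewrite val_liftX -[val _](subrK 1) addrC.
rewrite (expr_pexpn_comm_add _ pM); last by apply: commr_sym; apply: commr1.
rewrite expr1n (@banded_eq0 _ _ (p ^ m.+1 * 1) (_ ^+ _)) ?addr0 //.
  by rewrite muln1; apply: ltnW; apply: ltn_expl.
by apply: banded_exp; apply: banded1_lift.
Qed.

Lemma iter_corner k (v : 'cV_m.+1) : iter k (mulmx (1 + E)) v = (1 + k%:R *: E) *m v.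
Proof.
rewrite -corner_exp; elim: k => [|k IHk] /=; first by rewrite expr0 mul1mx.
by rewrite IHk mulmxA exprS.
Qed.

Definition unitriangular_action : cyclic_action (free_group X) p.
Proof.
refine (@CyclicAction (free_group X) p 'cV[K]_m.+1
  (fun g v => val (fg_lift u g) *m v) (mulmx (1 + E)) m.+1 _ _ _ _ _ _).
- by move=> v; rewrite val_lift1 mul1mx.
- by move=> g h v; rewrite /= val_liftM mulmxA.
- by move=> g v; rewrite val_lift_pexpn mul1mx.
- by move=> g v; rewrite !mulmxA; congr (_ *m _); apply: corner_comm.
- by move=> v; rewrite iter_corner (pcharf0 pK) scale0r addr0 mul1mx.
- exists (delta_mx ord_max 0); rewrite mulmxDl mul1mx mul_delta_mx.
  rewrite -subr_eq0 addrAC subrr add0r; apply/eqP => /matrixP/(_ ord0 0)/eqP.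
  by rewrite !mxE !eqxx oner_eq0.
Defined.

End UnitriangularAction.

Section MinimalDegree.
Variables (n p j : nat).
Hypotheses (np : (n <= p)%N) (p2 : (2 < p)%N) (p_pr : prime p).
Hypotheses (j0 : (0 < j)%N) (jp : (j < p)%N).

Definition magnus_degree (y : free_group 'I_n) :=
  (forall I, (0 < size I < j)%N -> (p %| `|magnus_coef y I|)%N) /\
  (exists2 I, size I = j & ~~ (p %| `|magnus_coef y I|)%N).

(** Endomorphisms preserve vanishing modulo [p] below any degree. Applied to the inverse
    automorphism below [j.+1], this shows that degree [j] cannot vanish for [y]. *)
Lemma magnus_degree_Aut (x y : free_group 'I_n) :
  Aut_orbit x y -> magnus_degree x -> magnus_degree y.
Proof.
have pF := pchar_Fp p_pr.
have endo (f : {multiplicative free_group 'I_n -> free_group 'I_n}) k (w : free_group 'I_n) :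
    (forall I, (0 < size I < k)%N -> (p %| `|magnus_coef w I|)%N) ->
    forall I, (0 < size I < k)%N -> (p %| `|magnus_coef (f w) I|)%N.
  move=> w0 I sI; rewrite -(intr_eq0_pchar _ pF); apply/eqP.
  apply: (@magnus_coef_endo _ _ f k w _ I sI) => J sJ; apply/eqP.
  by rewrite (intr_eq0_pchar _ pF) w0.
move=> [f [[g fK gK] ->]] [x0 [I sI xI]]; split; first exact: endo.
have gM : {morph g : u v / (u * v)%g}.
  by move=> u v; apply: (can_inj fK); rewrite gK gmulfM !gK.
pose gm := isMultiplicative.Build _ _ g gM.
pose G : {multiplicative free_group 'I_n -> free_group 'I_n} := HB.pack g gm.
apply: contrapT => nex; case/negP: xI.
rewrite -(fK x); apply: (endo G j.+1); last by rewrite sI j0 /=.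
move=> J /andP[J0]; rewrite ltnS leq_eqVlt => /orP[/eqP sJ|sJ].
  by apply: contrapT => /negP nd; apply: nex; exists J.
by apply: (endo f j) => //; rewrite J0.
Qed.

Lemma magnus_degree_action : exists C : cyclic_action (free_group 'I_n) p,
  forall y, magnus_degree y -> exists k i,
    coprime p i /\ ca_act C (y ^+ k)%g =1 iter i (ca_rot C).
Proof.
(* This [d] gives enough conjugates for [path_sum_neq0], is prime to [j], and makes the [d]-th power
   additive; [m = d * j] places the [d]-th power of [B] in the corner. *)
pose d := (p ^ j)%N; pose m := (d * j)%N.
have d0 : (0 < d)%N by rewrite expn_gt0 prime_gt0.
have jd : coprime j d by rewrite coprimeXr // coprime_sym prime_coprime // gtnNdvd.
have [K pK cK] := pPrimePowerField p_pr d0.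
have [x injx] := exists_distinct_conjugates p2 cK.
pose u (i : 'I_n) := unitri m (conj_power p x i).
have u1 i : banded 1 (val (u i) - 1) by rewrite unitriE; apply: banded_superdiag.
have m0 : (0 < m)%N by rewrite muln_gt0 d0.
exists (unitriangular_action m0 pK u1) => y [y0 [I sI yI]].
pose B := val (fg_lift u y) - 1.
have Bj : banded j B.
  apply: banded_lift => // J sJ; apply/eqP.
  by rewrite (intr_eq0_pchar _ pK) y0.
have BE (r s : 'I_m.+1) : s = (r + j)%N :> nat ->
    B r s = path_sum (conj_power p x) j 0 (magnus_coef y) ^+ (p ^ r).
  move=> es; rewrite -path_sum_Frobenius // -(lift_entry u1 _ _ es); last first.
    by move=> i t t'; rewrite unitriE mxE.
  rewrite /B !mxE -val_eqE /= es -[X in X == _]addn0 eqn_add2l.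
  by rewrite eq_sym gtn_eqF // subr0.
have b0 : path_sum (conj_power p x) j 0 (magnus_coef y) != 0.
  by apply: (path_sum_neq0 np pK injx _ sI); rewrite ?(intr_eq0_pchar _ pK).
have [i pi e] := twisted_norm_natr pK cK j0 jd b0.
exists d, i; split=> // v.
transitivity ((1 + i%:R *: delta_mx ord0 ord_max) *m v); last first.
  by apply/esym; apply: iter_corner.
rewrite [LHS]/= val_liftX; congr (_ *m _).
rewrite -[val _](subrK 1) addrC -/B.
rewrite (expr_pexpn_comm_add _ (p := p)); last 2 first.
- by rewrite pchar_lalg.
- by apply: commr_sym; apply: commr1.
by rewrite expr1n -e (exp_superdiag Bj BE).
Qed.

End MinimalDegree.

Lemma exists_cyclic_action n (x : free_group 'I_n) b : x != 1%g ->
  exists p (C : cyclic_action (free_group 'I_n) p),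
    [/\ prime p, (b < p)%N & forall y, Aut_orbit x y -> exists k i,
      coprime p i /\ ca_act C (y ^+ k)%g =1 iter i (ca_rot C)].
Proof.
move=> x1; have [I I0 xI] : exists2 I, I != [::] & magnus_coef x I != 0.
  by apply: magnus_coef_neq0; [exact: valP | apply: contraNneq x1 => e; apply/eqP/val_inj].
(* The summands ensure in turn: coprimality to earlier exponents, separation of base [p] digits,
   [2 < p], [j < p], and a coefficient that survives modulo [p]. *)
have [p ltp p_pr] := prime_above (b + n + 2 + size I + `|magnus_coef x I|).
have xpI : ~~ (p %| `|magnus_coef x I|)%N by rewrite gtnNdvd ?absz_gt0 //; lia.
pose P j := (0 < j)%N && [exists I : j.-tuple 'I_n, ~~ (p %| `|magnus_coef x I|)%N].
have exP : exists j, P j.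
  exists (size I); rewrite /P lt0n size_eq0 I0; apply/existsP.
  by exists (in_tuple I).
case: (ex_minnP exP) => j /andP[j0 /existsP[J xJ]] minj.
have jI : (j <= size I)%N.
  by apply: minj; rewrite /P lt0n size_eq0 I0; apply/existsP; exists (in_tuple I).
have degx : magnus_degree p j x.
  split; last by exists J; rewrite ?size_tuple.
  move=> J' /andP[J'0 J'j]; apply: contraLR J'j => nd; rewrite -leqNgt.
  by apply: minj; rewrite /P J'0; apply/existsP; exists (in_tuple J').
have np : (n <= p)%N by lia.
have p2 : (2 < p)%N by lia.
have jp : (j < p)%N by lia.
have [C CP] := magnus_degree_action np p2 p_pr j0 jp.
exists p, C; split=> // [|y xy]; first by lia.
by apply: CP; apply: magnus_degree_Aut xy degx.
Qed.

(** * Modules in which powers fix no vector *)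

Lemma iter_coprime_fix (T : Type) (f : T -> T) (x : T) a b : coprime a b ->
  (0 < a)%N -> iter a f x = x -> iter b f x = x -> f x = x.
Proof.
move=> ab a0 fa fb.
have fix_mul c k : iter c f x = x -> iter (k * c) f x = x.
  by move=> fc; elim: k => // k IHk; rewrite mulSn iterD IHk.
case: (egcdnP b a0) => u v e _; rewrite (eqP ab) addn1 in e.
by rewrite -[in RHS](fix_mul a u fa) e iterS fix_mul.
Qed.

(* The module is the subgroup [rm_sub] of the ambient space; [rm_key] records
   that [G] acts through a finite quotient, and [rm_exp] an exponent of it. *)
Record rat_module (G : groupType) := RatModule {
  rm_type :> lmodType rat;
  rm_act : G -> rm_type -> rm_type;
  rm_sub : rm_type -> Prop;
  rm_fin : finType;
  rm_key : G -> rm_fin;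
  rm_exp : nat;
  rm_actB : forall g u v, rm_act g (u - v) = rm_act g u - rm_act g v;
  rm_act1 : rm_act 1%g =1 id;
  rm_actM : forall g h v, rm_act (g * h)%g v = rm_act g (rm_act h v);
  rm_subB : forall u v, rm_sub u -> rm_sub v -> rm_sub (u - v);
  rm_sub_act : forall g v, rm_sub v -> rm_sub (rm_act g v);
  rm_sub_neq0 : exists2 v, rm_sub v & v != 0;
  rm_act_key : forall g h, rm_key g = rm_key h -> rm_act g =1 rm_act h;
  rm_exp_gt0 : (0 < rm_exp)%N;
  rm_actX : forall g, rm_act (g ^+ rm_exp)%g =1 id }.

Arguments rm_act {G} M g : rename.
Arguments rm_sub {G} M v : rename.
Arguments rm_key {G} M g : rename.
Arguments rm_exp {G} M : rename.

Section RatModuleTheory.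
Variables (G : groupType) (M : rat_module G).
Implicit Types (g h : G) (u v : M).

Lemma rm_act0 g : rm_act M g 0 = 0.
Proof. by have := rm_actB g (0 : M) 0; rewrite !subrr. Qed.

Lemma rm_actN g v : rm_act M g (- v) = - rm_act M g v.
Proof. by have := rm_actB g 0 v; rewrite rm_act0 !sub0r. Qed.

Lemma rm_actD g u v : rm_act M g (u + v) = rm_act M g u + rm_act M g v.
Proof. by rewrite -{1}[v]opprK rm_actB rm_actN opprK. Qed.

Lemma rm_act_sum (I : Type) (r : seq I) (P : pred I) (F : I -> M) g :
  rm_act M g (\sum_(i <- r | P i) F i) = \sum_(i <- r | P i) rm_act M g (F i).
Proof. exact: (big_morph _ (rm_actD g) (rm_act0 g)). Qed.

Lemma rm_actKV g v : rm_act M g^-1%g (rm_act M g v) = v.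
Proof. by rewrite -rm_actM mulVg rm_act1. Qed.

Lemma rm_act_iter g k v : rm_act M (g ^+ k)%g v = iter k (rm_act M g) v.
Proof.
by elim: k => [|k IHk]; [rewrite rm_act1 | rewrite expgS rm_actM IHk].
Qed.

Lemma rm_sub0 : rm_sub M 0.
Proof. by have [v vM _] := rm_sub_neq0 M; rewrite -(subrr v); apply: rm_subB. Qed.

Lemma rm_subD u v : rm_sub M u -> rm_sub M v -> rm_sub M (u + v).
Proof.
move=> uM vM; rewrite -[v]opprK; apply: (rm_subB uM).
by rewrite -sub0r; apply: rm_subB rm_sub0 vM.
Qed.

(** Absence of fixed vectors kills cocycles on powers of [y]; centrality puts commutators with
    [y ^+ k] into the kernel of the action. *)
Definition central_fixfree_power (y : G) := exists k,
  (forall g v,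
     rm_act M (y ^+ k)%g (rm_act M g v) = rm_act M g (rm_act M (y ^+ k)%g v)) /\
  (forall v, rm_sub M v -> rm_act M (y ^+ k)%g v = v -> v = 0).

End RatModuleTheory.

Arguments central_fixfree_power {G} M y.

Definition trivial_rat_module (G : groupType) : rat_module G.
Proof.
refine (@RatModule G rat^o (fun _ v => v) (fun _ => True) unit (fun _ => tt) 1
  _ _ _ _ _ _ _ _ _) => //.
by exists 1; rewrite ?oner_eq0.
Defined.

(** * Tensoring a module with functions on a cyclic action *)

Section InducedModule.
Variables (G : groupType) (M : rat_module G) (p : nat) (C : cyclic_action G p).
Hypothesis p_pr : prime p.
Local Notation T := (ca_type C).
Local Notation rot := (ca_rot C).
Local Notation V := {ffun T -> M}.

Lemma ca_actVK g t : ca_act C g (ca_act C g^-1%g t) = t.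
Proof. by have /= <- := ca_actM C g g^-1%g t; rewrite mulgV ca_act1. Qed.

Lemma ca_actKV g t : ca_act C g^-1%g (ca_act C g t) = t.
Proof. by have /= <- := ca_actM C g^-1%g g t; rewrite mulVg ca_act1. Qed.

Lemma ca_act_iter_rot g k t : ca_act C g (iter k rot t) = iter k rot (ca_act C g t).
Proof. by elim: k => //= k IHk; rewrite ca_act_rot IHk. Qed.

(** The diagonal action on the tensor product of [M] with the rational functions on [T]. *)
Definition fun_act g (f : V) : V :=
  [ffun t => rm_act M g (f (ca_act C g^-1%g t))].

Lemma fun_actE g f t : fun_act g f t = rm_act M g (f (ca_act C g^-1%g t)).
Proof. exact: ffunE. Qed.

(* The zero sum condition leaves no nonzero function invariant under [rot]. *)
Definition fun_sub (f : V) : Prop :=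
  (forall t, rm_sub M (f t)) /\
  (forall t, \sum_(i < p) f (iter i rot t) = 0).

(** For a function [h] supported at a point moved by the rotation, [h - h \o rot] has telescoping
    orbit sums. *)
Lemma fun_sub_neq0 : exists2 f, fun_sub f & f != 0.
Proof.
have [v vM v0] := rm_sub_neq0 M; have [t0 rt0] := ca_rot_neq C.
pose h t : M := if t == t0 then v else 0.
exists [ffun t => h t - h (rot t)]; last first.
  apply: contraNneq v0 => /ffunP/(_ t0); rewrite !ffunE /h eqxx (negPf rt0) subr0.
  by move->.
split=> t.
  by rewrite ffunE; apply: rm_subB; rewrite /h; case: ifP => // _; apply: rm_sub0.
under eq_bigr do rewrite ffunE -iterS -opprB.
rewrite sumrN -(big_mkord xpredT (fun i => h (iter i.+1 rot t) - h (iter i rot t))).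
by rewrite telescope_sumr // (ca_rotX C) subrr oppr0.
Qed.

Definition fun_module : rat_module G.
Proof.
refine (@RatModule G V fun_act fun_sub
  (rm_fin M * {ffun T -> T})%type
  (fun g => (rm_key M g, [ffun t => ca_act C g^-1%g t]))
  (rm_exp M * p ^ ca_exp C) _ _ _ _ _ fun_sub_neq0 _ _ _).
- by move=> g f f'; apply/ffunP => t; rewrite !ffunE rm_actB.
- move=> f; apply/ffunP => t; rewrite !ffunE rm_act1; congr (f _).
  by rewrite -[in LHS](ca_act1 C t) ca_actKV.
- move=> g h f; apply/ffunP => t; rewrite !ffunE rm_actM invMg.
  by rewrite (ca_actM C).
- move=> f f' [fM f0] [f'M f'0]; split=> t; first by rewrite !ffunE; apply: rm_subB.
  by under eq_bigr do rewrite !ffunE; rewrite sumrB f0 f'0 subrr.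
- move=> g f [fM f0]; split=> t; first by rewrite ffunE; apply: rm_sub_act.
  under eq_bigr do rewrite ffunE ca_act_iter_rot.
  by rewrite -rm_act_sum f0 rm_act0.
- move=> g h [/rm_act_key Mgh /ffunP Cgh] f; apply/ffunP => t.
  by rewrite !ffunE Mgh; have := Cgh t; rewrite !ffunE => ->.
- by rewrite muln_gt0 rm_exp_gt0 expn_gt0 prime_gt0.
- move=> g f; apply/ffunP => t; rewrite !ffunE -{1}[t](ca_actX C (g ^+ rm_exp M)%g).
  by rewrite -expgM ca_actKV mulnC expgM rm_actX.
Defined.

Lemma central_fixfree_power_fun y :
  (exists k,
    (forall g f,
       fun_act (y ^+ k)%g (fun_act g f) = fun_act g (fun_act (y ^+ k)%g f)) /\
    (forall f, fun_sub f -> fun_act (y ^+ k)%g f = f -> f = 0)) ->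
  central_fixfree_power fun_module y.
Proof. by []. Qed.

Hypothesis expM : coprime (rm_exp M) p.

(* The exponents of the two actions are coprime, so a suitable power of [y] acts
   on the values only, or on the arguments only. *)
Lemma fun_module_old y :
  central_fixfree_power M y -> central_fixfree_power fun_module y.
Proof.
move=> [k [ck fk]]; apply: central_fixfree_power_fun; exists (k * p ^ ca_exp C)%N.
have actE (f : V) t :
    fun_act (y ^+ (k * p ^ ca_exp C))%g f t =
    iter (p ^ ca_exp C) (rm_act M (y ^+ k)%g) (f t).
  rewrite fun_actE -{1}[t](ca_actX C (y ^+ k)%g) -expgM ca_actKV.
  by rewrite expgM rm_act_iter.
split=> [g f|f [fM _] ff].
  apply/ffunP => t; rewrite actE fun_actE [RHS]fun_actE actE.
  by elim: (p ^ _)%N => //= e ->; rewrite ck.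
apply/ffunP => t; rewrite [RHS]ffunE; apply: fk => //.
(* The value is fixed by two powers of the action of [y ^+ k] with coprime exponents. *)
apply: (@iter_coprime_fix _ _ _ (rm_exp M) (p ^ ca_exp C)).
- by rewrite coprimeXr.
- exact: rm_exp_gt0.
- by rewrite -rm_act_iter rm_actX.
- by rewrite -actE ff.
Qed.

(** Some power of [y] rotates the arguments by an amount prime to [p], so a fixed function is
    rotation-invariant; its orbit sum is then [p] times its value, and also zero. *)
Lemma fun_module_new y k i : coprime p i ->
  ca_act C (y ^+ k)%g =1 iter i rot -> central_fixfree_power fun_module y.
Proof.
move=> pi yk; apply: central_fixfree_power_fun; exists (k * rm_exp M)%N.
set N := rm_exp M.
have ykN t : ca_act C (y ^+ (k * N))%g t = iter (i * N) rot t.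
  rewrite expgM mulnC; elim: N => [|c IHc]; first by rewrite ca_act1.
  by rewrite expgS ca_actM /= IHc yk mulSn iterD.
have actE (f : V) t : fun_act (y ^+ (k * N))%g f t =
    f (ca_act C (y ^+ (k * N))^-1%g t).
  by rewrite fun_actE expgM /N rm_actX.
split=> [g f|f [_ f0] ff].
  apply/ffunP => t; rewrite actE fun_actE [RHS]fun_actE actE; congr (rm_act _ _ (f _)).
  rewrite -[LHS](ca_actKV (y ^+ (k * N))%g); congr (ca_act _ _ _).
  by rewrite ykN -ca_act_iter_rot -ykN ca_actVK.
have frot t : f (iter (i * N) rot t) = f t.
  by rewrite -ykN -{1}ff actE ca_actKV.
have {}frot t : f (rot t) = f t.
  pose F (h : T -> M) := h \o rot.
  have iterF c h s : iter c F h s = h (iter c rot s).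
    by elim: c s => // c IHc s; move: (IHc (rot s)); rewrite -iterSr.
  suff e : F f = f by rewrite -[in RHS]e.
  apply: (@iter_coprime_fix _ F f (i * N) p).
  - by rewrite coprimeMl (coprime_sym i) pi.
  - rewrite muln_gt0 rm_exp_gt0 andbT lt0n; apply: contraTneq pi => ->.
    by rewrite coprime_sym /coprime gcd0n; case: (p) p_pr => [|[]].
  - by apply: funext => s; rewrite iterF frot.
  - by apply: funext => s; rewrite iterF (ca_rotX C).
apply/ffunP => t; rewrite [RHS]ffunE; have := f0 t.
have fi c : f (iter c rot t) = f t by elim: c => //= c IHc; rewrite frot.
under eq_bigr do rewrite fi.
rewrite sumr_const card_ord -scaler_nat => /eqP; rewrite scaler_eq0.
by rewrite pnatr_eq0 gtn_eqF ?prime_gt0 // => /eqP.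
Qed.

End InducedModule.

(** Each new prime exceeds the exponent of the module built so far, so earlier orbits keep their
    property while the new one gains it. *)
Lemma exists_rat_module n (s : seq (free_group 'I_n)) :
  exists M : rat_module (free_group 'I_n),
    forall x y, x \in s -> x != 1%g -> Aut_orbit x y -> central_fixfree_power M y.
Proof.
elim: s => [|x s [M MP]]; first by exists (trivial_rat_module _).
have [->|x1] := eqVneq x 1%g.
  exists M => x' y; rewrite inE => /predU1P[->|x's] x'1; last exact: MP.
  by rewrite eqxx in x'1.
have [p [C [p_pr ltp CP]]] := exists_cyclic_action (rm_exp M) x1.
have expM : coprime (rm_exp M) p.
  by rewrite coprime_sym prime_coprime // gtnNdvd // rm_exp_gt0.
exists (fun_module M C p_pr) => x' y; rewrite inE => /predU1P[->|x's] x'1 xy.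
  by have [k [i [pi yk]]] := CP y xy; apply: fun_module_new yk.
exact: fun_module_old (MP x' y x's x'1 xy).
Qed.

(** * Cocycles and homology *)

Section Cocycle.
Variables (X : choiceType) (M : rat_module (free_group X)) (b : X -> M).
Hypothesis bM : forall i, rm_sub M (b i).
Implicit Types (a : letter X) (w : seq (letter X)) (g h : free_group X).

Let gen a : free_group X := letter_eval (@fg_gen X) a.

(** The value at an inverse letter is forced by [c(x^-1) = - x^-1 c(x)]. *)
Definition letter_cocycle a : M :=
  if a.2 then - rm_act M (gen a) (b a.1) else b a.1.

Definition word_cocycle w : M :=
  foldr (fun a v => letter_cocycle a + rm_act M (gen a) v) 0 w.

Definition cocycle g : M := word_cocycle g.

Lemma letter_cocycleV a :
  letter_cocycle (letter_inv a) = - rm_act M (gen (letter_inv a)) (letter_cocycle a).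
Proof.
case: a => i [] //=; rewrite /letter_cocycle /= rm_actN opprK -rm_actM.
by rewrite /gen letter_evalV mulVg rm_act1.
Qed.

Lemma word_cocycle_push a w :
  word_cocycle (push a w) = letter_cocycle a + rm_act M (gen a) (word_cocycle w).
Proof.
case: w => [|c w] //=; case: eqP => [->|//] /=.
rewrite letter_cocycleV rm_actD rm_actN -!rm_actM.
by rewrite /gen letter_evalV mulgV !rm_act1 addrA subrr add0r.
Qed.

Lemma fg_lift_fg_gen g : fg_lift (@fg_gen X) g = g.
Proof.
pose im := isMultiplicative.Build (free_group X) (free_group X) idfun (fun _ _ => erefl).
pose I : {multiplicative free_group X -> free_group X} := HB.pack idfun im.
by rewrite -(@fg_lift_unique _ _ _ I).
Qed.

Lemma cocycleM g h : cocycle (g * h)%g = cocycle g + rm_act M g (cocycle h).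
Proof.
rewrite -[in rm_act M g _](fg_lift_fg_gen g) /cocycle /= /fg_lift /word_mul.
elim: (word_of g) => [|a w IHw] /=; first by rewrite big_nil rm_act1 add0r.
by rewrite word_cocycle_push IHw big_cons rm_actM rm_actD addrA.
Qed.

Lemma cocycle_gen i : cocycle (fg_gen i) = b i.
Proof. by rewrite /cocycle /= rm_act0 addr0. Qed.

Lemma cocycle_sub g : rm_sub M (cocycle g).
Proof.
rewrite /cocycle; elim: (word_of g) => [|a w IHw] /=; first exact: rm_sub0.
apply: rm_subD; last exact: rm_sub_act.
rewrite /letter_cocycle; case: ifP => // _; rewrite -sub0r.
by apply: rm_subB; [exact: rm_sub0 | exact: rm_sub_act].
Qed.

(** Expanding the cocycle on [x * x^k = x^k * x] shows that its value at [x^k] is fixed by [x],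
    hence by every power of [x]. *)
Lemma cocycleX_eq0 x k : central_fixfree_power M x ->
  rm_act M (x ^+ k)%g =1 id -> cocycle (x ^+ k)%g = 0.
Proof.
move=> [l [_ fixfree]] xk; apply: fixfree; first exact: cocycle_sub.
have fx : rm_act M x (cocycle (x ^+ k)%g) = cocycle (x ^+ k)%g.
  apply: (addrI (cocycle x)); rewrite -cocycleM -expgS expgSr cocycleM xk.
  by rewrite addrC.
by rewrite rm_act_iter; elim: l => //= l ->.
Qed.

End Cocycle.

Section Kernel.
Variables (G : groupType) (M : rat_module G).

Definition rm_ker : {pred G} := [pred g | `[< rm_act M g =1 id >]].

Lemma rm_kerP g : reflect (rm_act M g =1 id) (g \in rm_ker).
Proof. by rewrite inE; apply: asboolP. Qed.

Fact rm_ker_mul1 : 1%g \in rm_ker.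
Proof. by apply/rm_kerP; apply: rm_act1. Qed.

Fact rm_ker_mul : mulg_closed rm_ker.
Proof.
by move=> g h /rm_kerP gk /rm_kerP hk; apply/rm_kerP => v; rewrite rm_actM hk gk.
Qed.

Fact rm_ker_inv : invg_closed rm_ker.
Proof.
by move=> g /rm_kerP gk; apply/rm_kerP => v; rewrite -{1}[v]gk rm_actKV.
Qed.

Definition rm_kernel : groupClosed G :=
  HB.pack rm_ker (isMul1Closed.Build G rm_ker rm_ker_mul1)
    (isMulClosed.Build G rm_ker rm_ker_mul) (isInvClosed.Build G rm_ker rm_ker_inv).

Lemma rm_ker_normal : normal_subgroup rm_kernel.
Proof.
move=> g h /rm_kerP gk; apply/rm_kerP => v.
by rewrite conjgE !rm_actM gk -rm_actM mulVg rm_act1.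
Qed.

Lemma rm_ker_finite_index : finite_index rm_kernel.
Proof.
(* One representative for each key; keys that are not attained yield the default [1]. *)
exists [seq xget 1%g [set g | rm_key M g = t]%classic | t <- enum (rm_fin M)] => x.
exists (xget 1%g [set g | rm_key M g = rm_key M x]%classic).
  by apply: map_f; rewrite mem_enum.
set y := xget _ _; have /rm_act_key yx : rm_key M y = rm_key M x.
  by apply: (@xgetPex _ 1%g [set g | rm_key M g = rm_key M x]%classic); exists x.
by apply/rm_kerP => v; rewrite rm_actM -yx rm_actKV.
Qed.

End Kernel.

(** * Homomorphisms to rational vector spaces factor through first homology *)

Section HomologyMorphism.
Variables (G : groupType) (V : lmodType rat) (c : G -> V).
Hypothesis cM : forall g h, c (g * h)%g = c g + c h.

Let lift : chain1 G -> V := fglift c.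

Fact chain_liftB : {morph lift : z t / z - t}.
Proof. by move=> z t; rewrite /lift lift_is_additive. Qed.

Fact chain_lift0 : lift 0 = 0.
Proof. by have := chain_liftB 0 0; rewrite !subrr. Qed.

Fact chain_liftD : {morph lift : z t / z + t}.
Proof.
move=> z t; have := chain_liftB z (- t); rewrite opprK => ->.
by have := chain_liftB 0 t; rewrite chain_lift0 !sub0r => ->; rewrite opprK.
Qed.

Fact chain_lift_sum (I : Type) (r : seq I) (F : I -> chain1 G) :
  lift (\sum_(i <- r) F i) = \sum_(i <- r) lift (F i).
Proof. exact: (big_morph lift chain_liftD chain_lift0). Qed.

Fact chain_liftZ (a : rat) z : lift (a *: z) = a *: lift z.
Proof.
transitivity (lift (fgscale a z)); first by [].
rewrite -{2}[z]freeg_sumE /fgscale !chain_lift_sum scaler_sumr.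
by apply: eq_bigr => x _; rewrite /lift !liftU scalerA.
Qed.

Lemma chain_lift_of (x : G) : lift (chain1_of x) = c x.
Proof. by rewrite /lift /chain1_of liftU scale1r. Qed.

Lemma chain_lift_boundaries (z : chain1 G) : z \in @boundaries1 G -> lift z = 0.
Proof.
move=> /set_mem[s sb ->].
rewrite chain_lift_sum big_seq big1 // => p /sb[[g h] _ <-].
rewrite chain_liftZ /boundary2 chain_liftD chain_liftB !chain_lift_of /= cM.
by rewrite [c g + _]addrC opprD addrA subrr add0r addNr scaler0.
Qed.

Definition H1_lift (z : H1 G) : V := lift (generic_quotient.repr z).

Lemma H1_lift_chain (z : chain1 G) : H1_lift (chain1_class z) = lift z.
Proof.
apply/eqP; rewrite -subr_eq0 -chain_liftB; apply/eqP/chain_lift_boundaries.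
by apply/chain1_classP; apply: generic_quotient.reprK.
Qed.

Lemma H1_lift_class (x : G) : H1_lift (H1_class x) = c x.
Proof. by rewrite H1_lift_chain chain_lift_of. Qed.

Lemma H1_lift_span (A : set (H1 G)) (z : H1 G) :
  (forall v, A v -> H1_lift v = 0) -> lspan A z -> H1_lift z = 0.
Proof.
move=> A0 [s sA ->]; have D : {morph H1_lift : u v / u + v}.
  elim/H1_ind => z1; elim/H1_ind => z2.
  by rewrite -chain1_classD !H1_lift_chain chain_liftD.
have Z a u : H1_lift (a *: u) = a *: H1_lift u.
  by elim/H1_ind: u => z1; rewrite [_ *: _]H1_scaleE !H1_lift_chain chain_liftZ.
have H0 : H1_lift 0 = 0 by have := Z 0 0; rewrite !scale0r.
rewrite (big_morph H1_lift D H0) big_seq big1 // => p /sA/A0.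
by rewrite Z => ->; rewrite scaler0.
Qed.

End HomologyMorphism.

Local Open Scope classical_set_scope.

Theorem theorem3 (n : nat) (hn : (2 <= n)%N) (O : set (free_group 'I_n))
    (hO : exists s : seq (free_group 'I_n),
        O `<=` \bigcup_(x in [set` s]) Aut_orbit x) :
  exists R : groupClosed (free_group 'I_n),
    [/\ normal_subgroup R, finite_index R &
        H1_power_span O R <> [set: H1 (subgroup R)]].
Proof.
case: hO => s Os; pose i0 : 'I_n := Ordinal (ltnW hn); pose i1 := Ordinal hn.
(* The generator [fg_gen i0] is added to the list to supply the central power [z] below. *)
have [M MP] := exists_rat_module (fg_gen i0 :: s).
exists (rm_kernel M); split; [exact: rm_ker_normal | exact: rm_ker_finite_index |].
move=> spanT; have [w wM w0] := rm_sub_neq0 M.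
(* The cocycle vanishes on powers of the generator [i0] and takes a nonzero value at the generator
   [i1]. *)
pose b i := if i == i1 then w else 0.
have bM i : rm_sub M (b i) by rewrite /b; case: ifP => // _; apply: rm_sub0.
pose c := cocycle b; pose cR (r : subgroup (rm_kernel M)) := c (val r).
have cRM g h : cR (g * h)%g = cR g + cR h.
  rewrite /cR /c cocycleM; congr (_ + _).
  by have /rm_kerP -> := valP g.
have c0 r : r \in rm_kernel M -> c r = 0.
  move=> rR; pose r' : subgroup (rm_kernel M) := Sub r rR.
  rewrite -[c r]/(cR r') -(H1_lift_class cRM).
  apply: (H1_lift_span cRM (A := [set v | exists x k
    (xkR : (x ^+ k)%g \in rm_kernel M),
    [/\ O x, (1 <= k)%N & v = H1_class (Sub (x ^+ k)%g xkR : subgroup (rm_kernel M))]])).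
    move=> _ [x [k [xkR [Ox _ ->]]]]; rewrite (H1_lift_class cRM) /cR /=.
    (* The module says nothing about the trivial element, but its powers have cocycle value zero. *)
    have [-> |x1] := eqVneq x 1%g; first by rewrite expg1n.
    have [y ys yx] := Os x Ox.
    have y1 : y != 1%g.
      apply: contraNneq x1 => y1; case: yx => f [_ ->]; rewrite y1.
      apply/eqP/(mulgI (f 1%g)).
      by rewrite -gmulfM !mulg1.
    apply: cocycleX_eq0 => //; last exact/rm_kerP.
    by apply: MP yx; rewrite ?inE ?ys ?orbT.
  by have : H1_power_span O (rm_kernel M) (H1_class r') by rewrite spanT.
have [k [central fixfree]] : central_fixfree_power M (fg_gen i0).
  apply: (MP (fg_gen i0)); rewrite ?mem_head //.
  by exists idfun; split=> //; exists idfun.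
set z := (fg_gen i0 ^+ k)%g in central fixfree; set h := fg_gen i1.
have cz : c z = 0.
  rewrite /z; elim: k {central fixfree z} => // k IHk.
  by rewrite expgS /c cocycleM [cocycle b (_ ^+ _)%g]IHk rm_act0 addr0 cocycle_gen.
have ch : c h = w by rewrite /c cocycle_gen /b eqxx.
case/eqP: w0; apply: fixfree => //.
(* Hence [c (z * h) = c (h * z)]. The left side is [z] applied to [w] and the right side is [w], so
   [z] fixes [w]. *)
have rR : ((h * z)^-1 * (z * h))%g \in rm_kernel M.
  apply/rm_kerP => v; rewrite rm_actM (rm_actM z) central -rm_actM.
  exact: rm_actKV.
have := cocycleM b (h * z)%g ((h * z)^-1 * (z * h))%g.
rewrite mulVKg [cocycle b (_^-1 * _)%g](c0 _ rR) rm_act0 addr0 !cocycleM.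
by rewrite [cocycle b z]cz [cocycle b h]ch rm_act0 addr0 add0r.
Qed.
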